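(* Let $A=(A,\oplus,\odot)$ be a two-sided skew brace with additive group $A_{\oplus}$ and multiplicative group $A_{\odot}$. Then: \begin{enumerate} \item If $A$ is finite and $A_{\oplus}$ is solvable, then $A_{\odot}$ is solvable. \item If $A_{\oplus}$ is finitely generated and nilpotent, then $A_{\odot}$ is solvable. \item If $A_{\oplus}$ is finitely generated and residually nilpotent, then $A_{\odot}$ is residually solvable. \item If $A_{\oplus}$ is finitely generated and residually finite, then $A_{\odot}$ is residually finite. \end{enumerate}
   Context: A skew brace $A=(A,\oplus,\odot)$ is a set with two binary operations $\oplus,\odot$ such that $A_{\oplus}=(A,\oplus)$ (the additive group, not necessarily abelian) and $A_{\odot}=(A,\odot)$ (the multiplicative group) are groups and $a\odot(b\oplus c)=(a\odot b)\ominus a\oplus(a\odot c)$ for all $a,b,c\in A$. Here $\ominus a$ denotes the inverse of $a$ in $A_{\oplus}$, and $x\ominus y$ means $x\oplus(\ominus y)$. A skew brace $A$ is two-sided if in addition $(a\oplus b)\odot c=(a\odot c)\ominus c\oplus(b\odot c)$ for all $a,b,c\in A$. *)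

(* Defs.v *)
From HB Require Import structures.
From mathcomp Require Import all_boot all_fingroup all_solvable.
From mathcomp Require Import boolp classical_sets functions cardinality.

Set Implicit Arguments.
Unset Strict Implicit.
Unset Printing Implicit Defensive.

(* Possibly infinite groups are MathComp's [groupType]; subgroups are
   classical sets. *)
Section Groups.
Local Open Scope classical_set_scope.
Local Open Scope group_scope.

Section Subgroups.
Variable G : groupType.

Definition is_subgroup (H : set G) : Prop :=
  [/\ H 1, forall x y, H x -> H y -> H (x * y) & forall x, H x -> H x^-1].

Definition generated (S : set G) : set G := smallest is_subgroup S.

Definition commutator_subgroup (H K : set G) : set G :=
  generated [set [~ x, y] | x in H & y in K].

Definition derived_series (n : nat) : set G :=
  iter n (fun H => commutator_subgroup H H) [set: G].

Definition lower_central_series (n : nat) : set G :=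
  iter n (fun H => commutator_subgroup H [set: G]) [set: G].

End Subgroups.
Arguments derived_series G n%_N : clear implicits.
Arguments lower_central_series G n%_N : clear implicits.

Definition finitely_generated (G : groupType) : Prop :=
  exists S : set G, finite_set S /\ generated S = [set: G].

Definition finite_group (G : groupType) : Prop := finite_set [set: G].

Definition solvable_group (G : groupType) : Prop :=
  exists n, derived_series G n = [set 1].

Definition nilpotent_group (G : groupType) : Prop :=
  exists n, lower_central_series G n = [set 1].

(* Quotients of G are presented as surjective homomorphisms out of G. *)
Definition residually (P : groupType -> Prop) (G : groupType) : Prop :=
  forall g : G, g <> 1 ->
    exists (H : groupType) (f : {multiplicative G -> H}),
      [/\ range f = [set: H], P H & f g <> 1].

(* On finite groups these notions agree with the library's. *)
Section Finite.
Variable gT : finGroupType.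

Lemma generated_fin (A : {set gT}) : generated [set` A] = [set` <<A>>%g].
Proof.
apply/seteqP; split => x /=.
  move=> /(_ [set` <<A>>%g]); apply; split; last by move=> y /=; exact: mem_gen.
  by split=> [|y z /= yA zA|y /= yA]; rewrite /= ?group1 ?groupM ?groupV.
move=> /gen_prodgP[n [c cA ->]] H [[H1 HM HV] AH].
by elim/big_ind: _ => // i _; apply: AH; exact: cA.
Qed.

Lemma commutator_subgroup_fin (A B : {set gT}) :
  commutator_subgroup [set` A] [set` B] = [set` [~: A, B]%g].
Proof.
rewrite -generated_fin; congr generated; apply/seteqP; split => x /=.
  by move=> [y yA [z zB <-]]; apply/imset2P; exists y z.
by move=> /imset2P[y z yA zB ->]; exists y => //; exists z.
Qed.

Lemma set1_fin : [set` 1%g : {set gT}] = [set 1 : gT].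
Proof. by apply/seteqP; split => x /= /set1P. Qed.

Lemma setT_fin : [set` [set: gT]%SET] = [set: gT].
Proof. by apply/seteqP; split => x //= _; rewrite inE. Qed.

Lemma eq_set_fin (A B : {set gT}) : [set` A] = [set` B] <-> A = B.
Proof.
split=> [AB|-> //]; apply/setP => x; apply/idP/idP => xA.
  by change ([set` B] x); rewrite -AB.
by change ([set` A] x); rewrite AB.
Qed.

Lemma solvable_group_fin : solvable_group gT <-> solvable [set: gT]%SET.
Proof.
have dE n : derived_series gT n = [set` ([set: gT]%SET)^`(n)%g].
  elim: n => [|n IHn]; first by rewrite derg0 setT_fin.
  by rewrite dergSn -commutator_subgroup_fin -IHn.
split=> [[n]|/(derivedP [set: gT]%G)[n dn]].
  rewrite dE -set1_fin => /eq_set_fin dn.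
  by apply/(derivedP [set: gT]%G); exists n; rewrite dn.
by exists n; rewrite dE dn set1_fin.
Qed.

Lemma nilpotent_group_fin : nilpotent_group gT <-> nilpotent [set: gT]%SET.
Proof.
have lE n : lower_central_series gT n = [set` 'L_n.+1([set: gT]%SET)%g].
  elim: n => [|n IHn]; first by rewrite lcn1 setT_fin.
  by rewrite lcnSn -commutator_subgroup_fin -IHn setT_fin.
split=> [[n]|/(lcnP [set: gT]%G)[n ln]].
  by rewrite lE -set1_fin => /eq_set_fin ln; apply/(lcnP [set: gT]%G); exists n.
by exists n; rewrite lE ln set1_fin.
Qed.

End Finite.
End Groups.

Declare Scope brace_scope.
Delimit Scope brace_scope with brace.
Reserved Notation "a ⊕ b" (at level 50, left associativity).
Reserved Notation "a ⊖ b" (at level 50, left associativity).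
Reserved Notation "⊖ a" (at level 35, right associativity).
Reserved Notation "a ⊙ b" (at level 40, left associativity).

HB.mixin Record isSkewBrace (A : Type) := {
  badd : A -> A -> A;
  bzero : A;
  bopp : A -> A;
  baddA : associative badd;
  badd0l : left_id bzero badd;
  badd0r : right_id bzero badd;
  baddNl : left_inverse bzero bopp badd;
  baddNr : right_inverse bzero bopp badd;
  bmul : A -> A -> A;
  bone : A;
  binv : A -> A;
  bmulA : associative bmul;
  bmul1l : left_id bone bmul;
  bmul1r : right_id bone bmul;
  bmulVl : left_inverse bone binv bmul;
  bmulVr : right_inverse bone binv bmul;
  bmulDr : forall a b c,
    bmul a (badd b c) = badd (badd (bmul a b) (bopp a)) (bmul a c)
}.

#[short(type="skewBraceType")]
HB.structure Definition SkewBrace := {A of isSkewBrace A}.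

Notation "a ⊕ b" := (badd a b) : brace_scope.
Notation "⊖ a" := (bopp a) : brace_scope.
Notation "a ⊖ b" := (badd a (bopp b)) : brace_scope.
Notation "a ⊙ b" := (bmul a b) : brace_scope.

Definition two_sided (A : skewBraceType) : Prop :=
  forall a b c : A, ((a ⊕ b) ⊙ c = (a ⊙ c) ⊖ c ⊕ (b ⊙ c))%brace.

(* Copies of the carrier of A, equipped respectively with the group laws
   ⊕ and ⊙; the classical choice structure is required by [groupType]. *)
Definition additive_group (A : skewBraceType) : Type := A.
Definition multiplicative_group (A : skewBraceType) : Type := A.

Section BraceGroups.
Variable A : skewBraceType.

HB.instance Definition _ := gen_eqMixin (additive_group A).
HB.instance Definition _ := gen_choiceMixin (additive_group A).
HB.instance Definition _ := isGroup.Build (additive_group A)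
  (@baddA A) (@badd0l A) (@badd0r A) (@baddNl A) (@baddNr A).

HB.instance Definition _ := gen_eqMixin (multiplicative_group A).
HB.instance Definition _ := gen_choiceMixin (multiplicative_group A).
HB.instance Definition _ := isGroup.Build (multiplicative_group A)
  (@bmulA A) (@bmul1l A) (@bmul1r A) (@bmulVl A) (@bmulVr A).

End BraceGroups.

(* Main.v *)
From HB Require Import structures.
From mathcomp Require Import all_boot all_fingroup all_solvable.
From mathcomp Require Import ssralg ssrnum ssrint intdiv zify.
From mathcomp Require Import boolp classical_sets functions cardinality.
Require Import Defs.

(** In a two-sided skew brace, both the maps [lambda a] and the conjugations of
the multiplicative group are endomorphisms of the additive group
([lambdaM], [bmul_conjM]). Hence a fully invariant subgroup I of the additive
group is also a normal subgroup of the multiplicative group, with the same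
cosets ([ideal_subgroup], [ideal_conj], [ideal_cosetE]). For two such subgroups
J and I, the factor I / J therefore carries two group laws on one set.

The heart of the proof is that if the additive factor I / J is abelian and
finitely generated, then the multiplicative factor is solvable
([derived_abelian_factor]). When the additive factor is elementary abelian of
order p ^ k, the multiplicative one has order p ^ k as well, so it is a p-group
whose derived length is bounded in terms of k ([derived_elementary]). In
general this applies to the factors m V / p m V of V = I / J: their order is at
most p ^ n when V has n generators, so the bound on the derived length is the
same for all primes p, and a term of the derived series falls into p e V for all
primes p simultaneously. For a suitable e > 0 the intersection of the subgroups
p e V is trivial ([prime_multiples_eq0]).

The first two claims follow by going down the derived series, respectively the
lower central series, of the additive group: its factors are finitely generated,
in the second case because commutators of generators generate the next factor
([lcs_factor_generated]). For the third claim, if a nilpotent image of the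
additive group separates g from the identity, then so does the quotient by a
term of the lower central series, and the second argument shows that the
corresponding multiplicative quotient is solvable. For the fourth claim, the
kernel of a homomorphism to a finite group H is replaced by the intersection of
the kernels of all homomorphisms to H, which is fully invariant and still of
finite index ([common_kernel_finite_index]). *)

Set Implicit Arguments.
Unset Strict Implicit.
Unset Printing Implicit Defensive.

Local Open Scope classical_set_scope.
Local Open Scope group_scope.

Arguments derived_series G n%_N : clear implicits.
Arguments lower_central_series G n%_N : clear implicits.

(** * Fully invariant subgroups and the central and derived series *)

Lemma morph_one (G H : groupType) (f : G -> H) :
  {morph f : x y / x * y} -> f 1 = 1.
Proof. by move=> fM; apply: (mulgI (f 1)); rewrite -fM !mulg1. Qed.

Lemma morph_inv (G H : groupType) (f : G -> H) :
  {morph f : x y / x * y} -> {morph f : x / x^-1}.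
Proof.
by move=> fM x; apply: (mulgI (f x)); rewrite -fM !mulgV; exact: morph_one.
Qed.

Lemma morph_comm (G H : groupType) (f : G -> H) :
  {morph f : x y / x * y} -> {morph f : x y / [~ x, y]}.
Proof. by move=> fM x y; rewrite !commgEl !conjgE !(fM, morph_inv fM). Qed.

Section GroupSets.
Variable G : groupType.
Implicit Types (H I J K S : set G).

Lemma subgroup_generated S : is_subgroup (generated S).
Proof.
split=> [H [[]]//|x y xS yS H HS|x xS H HS]; case: (HS) => -[H1 HM HV] _.
  by apply: HM; [exact: xS | exact: yS].
by apply: HV; exact: xS.
Qed.

Lemma sub_generated S : S `<=` generated S.
Proof. by move=> x Sx H [_]; apply. Qed.

Lemma generated_sub S H : is_subgroup H -> S `<=` H -> generated S `<=` H.
Proof. by move=> gH SH x; apply. Qed.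

Lemma subgroupT : is_subgroup [set: G].
Proof. by []. Qed.

Lemma subgroup_conj H x y : is_subgroup H -> H x -> H y -> H (x ^ y).
Proof. by case=> H1 HM HV Hx Hy; rewrite conjgE; apply: (HM); [exact: HV|exact: HM]. Qed.

Lemma subgroup_comm H x y : is_subgroup H -> H x -> H y -> H [~ x, y].
Proof.
by move=> gH Hx Hy; case: (gH) => _ HM HV; rewrite commgEl; apply: HM; [exact: HV|exact: subgroup_conj].
Qed.

Lemma subgroup_expg H x n : is_subgroup H -> H x -> H (x ^+ n).
Proof. by case=> H1 HM HV Hx; elim: n => // n IHn; rewrite expgS; exact: HM. Qed.

Lemma commutator_subgroupS H H' K K' : H `<=` H' -> K `<=` K' ->
  commutator_subgroup H K `<=` commutator_subgroup H' K'.
Proof.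
move=> HH' KK'; apply: generated_sub; first exact: subgroup_generated.
move=> _ [x Hx [y Ky <-]]; apply: sub_generated.
by exists x; [exact: HH' | exists y => //; exact: KK'].
Qed.

Lemma mem_commutator H K x y : H x -> K y -> commutator_subgroup H K [~ x, y].
Proof. by move=> Hx Ky; apply: sub_generated; exists x => //; exists y. Qed.

(** The derived series started at an arbitrary subset, so that solvability of
a factor I / J can be said inside the ambient group: some term of the series
started at I lies in J. *)
Definition derived_from (n : nat) I : set G :=
  iter n (fun H => commutator_subgroup H H) I.

Lemma derived_fromS n I J : I `<=` J -> derived_from n I `<=` derived_from n J.
Proof. by move=> IJ; elim: n => //= n IHn; exact: commutator_subgroupS. Qed.

Lemma subgroup_derived_from n I : is_subgroup I -> is_subgroup (derived_from n I).
Proof. by case: n => // n _; exact: subgroup_generated. Qed.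

Lemma subgroup_lcs n : is_subgroup (lower_central_series G n).
Proof. by case: n => // n; exact: subgroup_generated. Qed.

(** Invariance under all endomorphisms, bijective or not: the terms of the two
series, the subgroups of multiples and the common kernels below all have it,
and it spares any discussion of inverses. *)
Definition fully_invariant I : Prop :=
  is_subgroup I /\
  forall f : G -> G, {morph f : x y / x * y} -> forall x, I x -> I (f x).

Lemma fully_invariant_normal I x y : fully_invariant I -> I x -> I (x ^ y).
Proof. by case=> _ fI; apply: (fI (conjg^~ y)) => u v; rewrite conjMg. Qed.

Lemma fully_invariantT : fully_invariant [set: G].
Proof. by []. Qed.

Lemma fully_invariant_commutator H K : fully_invariant H -> fully_invariant K ->
  fully_invariant (commutator_subgroup H K).
Proof.
move=> [gH fH] [gK fK]; split; first exact: subgroup_generated.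
move=> f fM; have [f1 fV] := (morph_one fM, morph_inv fM).
have [C1 CM CV] := subgroup_generated [set [~ x, y] | x in H & y in K].
apply: (@generated_sub _ (f @^-1` commutator_subgroup H K)).
  split=> [|x y|x] /=; rewrite ?f1 ?fM ?fV //; [exact: CM|exact: CV].
move=> _ [x Hx [y Ky <-]] /=; rewrite (morph_comm fM).
by apply: mem_commutator; [exact: fH|exact: fK].
Qed.

Lemma fully_invariant_derived n : fully_invariant (derived_series G n).
Proof.
elim: n => [|n IHn]; first exact: fully_invariantT.
exact: fully_invariant_commutator.
Qed.

Lemma fully_invariant_lcs n : fully_invariant (lower_central_series G n).
Proof.
elim: n => [|n IHn]; first exact: fully_invariantT.
exact: fully_invariant_commutator IHn fully_invariantT.
Qed.

Lemma fully_invariant_commutator_sub I : fully_invariant I ->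
  commutator_subgroup I [set: G] `<=` I.
Proof.
move=> fiI; have gI := fiI.1; apply: generated_sub => // _ [x Ix [y _ <-]].
case: gI => _ IM IV; rewrite commgEl; apply: IM; first exact: IV.
exact: fully_invariant_normal.
Qed.

End GroupSets.

Lemma lcs_morph (G H : groupType) (f : G -> H) n x :
  {morph f : x y / x * y} ->
  lower_central_series G n x -> lower_central_series H n (f x).
Proof.
move=> fM; elim: n x => // n IHn.
have [L1 LM LV] := @subgroup_lcs H n.+1.
apply: (@generated_sub _ _ (f @^-1` lower_central_series H n.+1)).
  split=> [|x y Lx Ly|x Lx]; rewrite /preimage/=.
  - by rewrite morph_one.
  - by rewrite fM; exact: LM.
  - by rewrite morph_inv //; exact: LV.
move=> _ [x Lx [y _ <-]]; rewrite /preimage/= morph_comm //.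
by apply: (mem_commutator (K := setT)) => //; exact: IHn.
Qed.

Lemma commMg_conj (G : groupType) (x y z : G) : [~ x * y, z] = [~ x, z] ^ y * [~ y, z].
Proof. by rewrite !commgEl !conjgE !invgM !mulgA !mulgK. Qed.

Lemma commgM_conj (G : groupType) (x y z : G) : [~ x, y * z] = [~ x, z] * [~ x, y] ^ z.
Proof. by rewrite !commgEl !conjgE !invgM !mulgA !mulgK. Qed.

(** Modulo the next term, a commutator [x, y] with x in the k-th term is
multiplicative in each argument; hence the commutators of a finite generating
set of the previous factor with the generators of G generate the next factor. *)
Lemma lcs_factor_generated (G : groupType) k : finitely_generated G ->
  exists S : set G, [/\ finite_set S, S `<=` lower_central_series G k &
    lower_central_series G k `<=`
      generated (S `|` lower_central_series G k.+1)].
Proof.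
move=> [S0 [finS0 genS0]]; elim: k => [|k [S [finS SI genI]]].
  exists S0; split=> // x _.
  have : generated S0 x by rewrite genS0.
  by apply: generated_sub; [exact: subgroup_generated | move=> y S0y; apply: sub_generated; left].
exists [set [~ x, y] | x in S & y in S0]; split.
- exact: finite_image2.
- by move=> _ [x Sx [y _ <-]]; apply: mem_commutator => //; exact: SI.
set I := lower_central_series G k in SI genI *.
set J := lower_central_series G k.+1; set J' := lower_central_series G k.+2.
set L := generated _.
have gL : is_subgroup L by exact: subgroup_generated.
have [L1 LM LV] := gL.
have J'L : J' `<=` L by move=> x J'x; apply: sub_generated; right.
have LJ : L `<=` J.
  apply: generated_sub; first exact: subgroup_lcs.
  move=> z [[x Sx [y _ <-]]|J'z]; first by apply: mem_commutator => //; exact: SI.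
  exact: (fully_invariant_commutator_sub (@fully_invariant_lcs G k.+1) J'z).
have comJL x y : J x -> L [~ x, y].
  by move=> Jx; apply: J'L; apply: (mem_commutator (K := setT) Jx).
have nL x y : L x -> L (x ^ y).
  move=> Lx; rewrite -[x ^ y](mulVKg x) -commgEl; apply: LM => //.
  by apply: comJL; exact: LJ.
(* The commutator of a fixed s with a product splits up to conjugation, and L is
   normal, so it suffices to test x on generators; afterwards the same for y. *)
have LS x s : I x -> S0 s -> L [~ x, s].
  move=> /genI Ix S0s.
  apply: (@generated_sub _ _ [set x | L [~ x, s]] _ _ x Ix).
    split=> [|y z /= Ly Lz|y /= Ly] /=.
    - by rewrite comm1g.
    - by rewrite commMg_conj; apply: LM => //; exact: nL.
    - have := commMg_conj y y^-1 s; rewrite mulgV comm1g => /esym/mulg1_eq <-.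
      by apply: LV; exact: nL.
  move=> y [Sy|Jy] /=; first by apply: sub_generated; left; exists y => //; exists s.
  exact: comJL.
apply: generated_sub => // _ [x Ix [y _ <-]].
have : generated S0 y by rewrite genS0.
apply: (@generated_sub _ _ [set y | L [~ x, y]]).
  split=> [|u v /= Lu Lv|u /= Lu] /=.
  - by rewrite commg1.
  - by rewrite commgM_conj; apply: LM => //; exact: nL.
  - have := commgM_conj x u^-1 u; rewrite mulVg commg1 => /esym/mulg1_eq e.
    by rewrite -[X in L X](conjgK u) -e; apply: nL; exact: LV.
by move=> s S0s; exact: LS.
Qed.

(** * Factor groups *)

Lemma finite_set_range (T : eqType) (S : set T) :
  finite_set S -> exists n (s : 'I_n -> T), S = range s.
Proof.
move=> /finite_seqP[t ->]; exists (size t), (tnth (in_tuple t)).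
apply/seteqP; split=> x /=; last by move=> [i _ <-]; exact: mem_tnth.
by move=> /(tnthP (in_tuple t))[i ->]; exists i.
Qed.

Lemma finite_set_inj (T : Type) (F : finType) (h : T -> F) :
  injective h -> finite_set [set: T].
Proof.
move=> h_inj; rewrite -(preimage_setT h).
by apply: finite_preimage => // x y _ _; exact: h_inj.
Qed.

(** A presentation of the factor group I / J by a map defined on the whole of
G but meaningful on I only, which avoids a type for the subgroup I. *)
Definition section_of (G Q : groupType) (I J : set G) (pi : G -> Q) : Prop :=
  [/\ forall x y, I x -> I y -> pi (x * y) = pi x * pi y,
      forall q, exists2 x, I x & pi x = q &
      forall x, I x -> (pi x = 1 <-> J x)].

(** The carrier consists of the cosets of J in I, as sets; the operations
go through chosen representatives. *)
Lemma exists_section (G : groupType) (I J : set G) :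
  is_subgroup I -> is_subgroup J ->
  (forall x y, J x -> I y -> J (x ^ y)) ->
  exists (Q : groupType) (pi : G -> Q), section_of I J pi.
Proof.
move=> [I1 IM IV] [J1 JM JV] nJ.
pose coset x := [set y | I y /\ J (x^-1 * y)].
pose T := {X : set G | exists2 x, I x & X = coset x}.
pose cl x : T := match pselect (I x) with
  | left Ix => exist _ (coset x) (ex_intro2 _ _ x Ix erefl)
  | right _ => exist _ (coset 1) (ex_intro2 _ _ 1 I1 erefl) end.
have clE x : I x -> sval (cl x) = coset x by rewrite /cl; case: pselect.
have svalI (X Y : T) : sval X = sval Y -> X = Y.
  case: X Y => [X pX] [Y pY] /= XY; case: _ / XY pY => pY.
  by rewrite (Prop_irrelevance pX pY).
have eqcl x y : I x -> I y -> (cl x = cl y <-> J (x^-1 * y)).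
  move=> Ix Iy; split=> [/(congr1 sval)|Jxy].
    rewrite !clE // => /seteqP[_ /(_ y)] /=.
    by case=> //; split => //; rewrite mulVg.
  apply: svalI; rewrite !clE //; apply/seteqP; split=> z [Iz Jz]; split=> //.
    by have := JM _ _ (JV _ Jxy) Jz; rewrite invgM invgK mulgA mulgK.
  by have := JM _ _ Jxy Jz; rewrite mulgA mulgK.
have [rep repI repK] : exists2 rep : T -> G,
    forall X, I (rep X) & forall X, cl (rep X) = X.
  have /choice[rep repP] : forall X : T, exists x, I x /\ cl x = X.
    by case=> X [x Ix XE]; exists x; split=> //; apply: svalI; rewrite clE.
  by exists rep => X; case: (repP X).
have clM x y x' y' : I x -> I y -> I x' -> I y' -> cl x = cl x' ->
    cl y = cl y' -> cl (x * y) = cl (x' * y').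
  move=> Ix Iy Ix' Iy' /eqcl-/(_ Ix Ix') Jx /eqcl-/(_ Iy Iy') Jy.
  apply/eqcl; [exact: IM|exact: IM|].
  have := JM _ _ (nJ _ y Jx Iy) Jy.
  by rewrite conjgE invgM !mulgA mulgK.
have clV x x' : I x -> I x' -> cl x = cl x' -> cl x^-1 = cl x'^-1.
  move=> Ix Ix' /eqcl-/(_ Ix Ix') Jx.
  apply/eqcl; [exact: IV|exact: IV|].
  have := nJ _ x^-1 (JV _ Jx) (IV _ Ix).
  by rewrite conjgE invgM !invgK !mulgA mulgK.
pose mul (X Y : T) := cl (rep X * rep Y).
pose inv (X : T) := cl (rep X)^-1.
have mulE x y : I x -> I y -> mul (cl x) (cl y) = cl (x * y).
  by move=> Ix Iy; apply: clM; rewrite ?repK.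
have invE x : I x -> inv (cl x) = cl x^-1.
  by move=> Ix; apply: clV; rewrite ?repK.
have onto X : exists2 x, I x & X = cl x by exists (rep X).
have mulA : associative mul.
  move=> X Y Z; have [x Ix ->] := onto X; have [y Iy ->] := onto Y.
  have [z Iz ->] := onto Z; rewrite (mulE y) // (mulE x y) // !mulE ?mulgA //; exact: IM.
have mul1X : left_id (cl 1) mul.
  by move=> X; have [x Ix ->] := onto X; rewrite mulE // mul1g.
have mulX1 : right_id (cl 1) mul.
  by move=> X; have [x Ix ->] := onto X; rewrite mulE // mulg1.
have mulVX : left_inverse (cl 1) inv mul.
  by move=> X; have [x Ix ->] := onto X; rewrite invE // mulE ?mulVg //; exact: IV.
have mulXV : right_inverse (cl 1) inv mul.
  by move=> X; have [x Ix ->] := onto X; rewrite invE // mulE ?mulgV //; exact: IV.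
pose C : choiceType := HB.pack T (gen_eqMixin T) (gen_choiceMixin T).
pose Q : groupType := HB.pack T C
  (isGroup.Build C mulA mul1X mulX1 mulVX mulXV).
exists Q, cl; split=> [x y Ix Iy|X|x Ix]; first exact/esym/mulE.
  by have [x Ix ->] := onto X; exists x.
split=> [e|Jx].
  by have /(eqcl 1 x I1 Ix) : cl 1 = cl x; rewrite ?invg1 ?mul1g.
by apply/esym/(eqcl 1 x I1 Ix); rewrite invg1 mul1g.
Qed.

(** Finitely many representatives suffice to make the factor group an object
of finite group theory, with a bound on its order. *)
Lemma exists_finite_section (G : groupType) (I J : set G) (T : finType)
    (r : T -> G) :
  is_subgroup I -> is_subgroup J -> J `<=` I ->
  (forall x y, J x -> I y -> J (x ^ y)) ->
  (forall x, I x -> exists2 t, I (r t) & J ((r t)^-1 * x)) ->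
  exists (F : finGroupType) (pi : G -> F),
    section_of I J pi /\ (#|F| <= #|T|)%N.
Proof.
move=> gI gJ JI nJ rP; have [I1 IM IV] := gI.
have [Q [pi secpi]] := exists_section gI gJ nJ; have [piM pi_onto piJ] := secpi.
have /choice[g gK] : forall q, exists t, pi (r t) = q.
  move=> q; have [x Ix <-] := pi_onto q; have [t It Jt] := rP x Ix.
  exists t; have /piJ : J ((r t)^-1 * x) by [].
  move=> /(_ (JI _ Jt)) e; rewrite -[x](mulVKg (r t)) piM ?e ?mulg1 //; exact: JI.
have gK' : cancel g (pi \o r) by move=> q; rewrite /= gK.
pose C : countType := HB.pack Q (CanIsCountable gK').
pose F : finGroupType := HB.pack Q C (@CanIsFinite C T g (pi \o r) gK').
exists F, pi; split=> //.
exact: (@leq_card F T g (can_inj gK')).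
Qed.

Section SectionTheory.
Variables (G Q : groupType) (I J : set G) (pi : G -> Q).
Hypotheses (gI : is_subgroup I) (secpi : section_of I J pi).

Lemma section_one : pi 1 = 1.
Proof.
case: secpi gI => piM _ _ [I1 _ _].
by apply: (mulgI (pi 1)); rewrite -piM // !mulg1.
Qed.

Lemma sectionV x : I x -> pi x^-1 = (pi x)^-1.
Proof.
case: secpi gI => piM _ _ [_ _ IV] Ix; apply: (mulgI (pi x)).
by rewrite -piM ?mulgV ?section_one //; exact: IV.
Qed.

Lemma sectionX x k : I x -> pi (x ^+ k) = pi x ^+ k.
Proof.
case: secpi => piM _ _ Ix; elim: k => [|k IHk]; first exact: section_one.
by rewrite !expgS piM ?IHk //; exact: subgroup_expg.
Qed.

Lemma sectionR x y : I x -> I y -> pi [~ x, y] = [~ pi x, pi y].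
Proof.
case: secpi gI => piM _ _ [_ IM IV] Ix Iy.
rewrite !commgEl !conjgE !(piM, sectionV) //; do ?[exact: IV | exact: IM].
by apply: (IM) => //; [exact: IV | exact: IM].
Qed.

Lemma section_eqP x y : I x -> I y -> (pi x = pi y <-> J (x^-1 * y)).
Proof.
case: secpi gI => piM _ piJ [_ IM IV] Ix Iy.
rewrite -piJ; last by apply: IM => //; exact: IV.
rewrite piM ?sectionV //; last exact: IV.
by split=> [->|/mulg1_eq]; [rewrite mulVg | rewrite invgK].
Qed.

Lemma derived_section n x :
  derived_from n I x -> I x /\ derived_series Q n (pi x).
Proof.
case: secpi gI => piM _ _ [I1 IM IV].
elim: n => [//|n IHn] in x *.
suff sub : derived_from n.+1 I `<=` [set x | I x /\ derived_series Q n.+1 (pi x)].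
  exact: sub.
apply: generated_sub.
  have [D1 DM DV] := subgroup_derived_from n.+1 (subgroupT Q).
  split=> [|y z [Iy Dy] [Iz Dz]|y [Iy Dy]]; first by split; rewrite // section_one.
    by split; [exact: IM | rewrite piM //; exact: DM].
  by split; [exact: IV | rewrite sectionV //; exact: DV].
move=> _ [y /IHn[Iy Dy] [z /IHn[Iz Dz] <-]].
split; first exact: subgroup_comm.
by rewrite sectionR //; exact: mem_commutator.
Qed.

End SectionTheory.

(** Together with [derived_section]: the derived series of I / J is the image
of the one started at I. *)
Lemma derived_section_onto (G Q : groupType) (I J : set G) (pi : G -> Q) n q :
  is_subgroup I -> section_of I J pi -> derived_series Q n q ->
  exists2 x, derived_from n I x & pi x = q.
Proof.
move=> gI secpi; have [piM pi_onto _] := secpi; have [_ IM IV] := gI.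
have DI m x : derived_from m I x -> I x by move=> /(derived_section gI secpi)[].
elim: n q => [q _|n IHn]; first exact: pi_onto.
have [D1 DM DV] := subgroup_derived_from n.+1 gI.
apply: generated_sub.
  split=> [|q q' [x Dx <-] [y Dy <-]|q [x Dx <-]].
  - by exists 1; rewrite // (section_one gI secpi).
  - by exists (x * y); [exact: DM | by rewrite piM //; exact: (DI n.+1)].
  - by exists x^-1; [exact: DV | rewrite (sectionV gI secpi) //; exact: (DI n.+1)].
move=> _ [q /IHn[x Dx <-] [q' /IHn[y Dy <-] <-]].
exists [~ x, y]; first exact: mem_commutator.
by apply: (sectionR gI secpi); [exact: DI Dx | exact: DI Dy].
Qed.

(** A group of order p ^ k has nilpotency class at most max 1 (k - 1), hence a
derived length bounded in terms of k alone. That the bound is independent of p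
is what makes the intersection over all primes in [derived_abelian_factor] work. *)
Lemma derived_pgroup (F : finGroupType) p n :
  prime p -> p.-group [set: F]%SET -> (#|F| <= p ^ n)%N -> derived_series F n.+1 = [set 1].
Proof.
move=> p_pr pF cardF.
have dE k : derived_series F k `<=` [set` 'L_k.+1([set: F]%SET)%g].
  elim: k => [|k IHk]; first by rewrite lcn1 setT_fin.
  rewrite lcnSn -commutator_subgroup_fin setT_fin.
  by apply: commutator_subgroupS.
apply/seteqP; split; last first.
  by move=> _ ->; case: (subgroup_derived_from n.+1 (subgroupT F)).
apply: (subset_trans (dE _)).
suff -> : 'L_n.+2([set: F]%SET)%g = 1%g by rewrite set1_fin.
apply/(lcn_nil_classP _ (pgroup_nil pF)).
apply: leq_trans (nil_class_pgroup pF) _; rewrite geq_max /=.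
apply: (leq_trans (leq_pred _)); apply: leqW.
by rewrite -(leq_exp2l _ _ (prime_gt1 p_pr)) cardsT -p_part part_pnat_id // -cardsT.
Qed.

(** * Abelian factor groups *)

Definition abelian_section_of (G : groupType) (V : zmodType) (I J : set G)
    (pi : G -> V) : Prop :=
  [/\ forall x y, I x -> I y -> pi (x * y) = (pi x + pi y)%R,
      forall v, exists2 x, I x & pi x = v &
      forall x, I x -> (pi x = 0%R <-> J x)].

Lemma exists_abelian_section (G : groupType) (I J : set G) :
  is_subgroup I -> is_subgroup J -> J `<=` I ->
  (forall x y, I x -> I y -> J [~ x, y]) ->
  exists (V : zmodType) (pi : G -> V), abelian_section_of I J pi.
Proof.
move=> gI gJ JI abIJ.
have nJ x y : J x -> I y -> J (x ^ y).
  move=> Jx Iy; rewrite -[x ^ y](mulVKg x) -commgEl.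
  by case: (gJ) => _ JM _; apply: JM => //; apply: abIJ => //; exact: JI.
have [Q [pi secpi]] := exists_section gI gJ nJ.
have [piM pi_onto piJ] := secpi.
have mulC : commutative (@mul Q).
  move=> q q'; have [[x Ix <-] [y Iy <-]] := (pi_onto q, pi_onto q').
  have [_ IM IV] := gI.
  rewrite -!piM //; apply/(section_eqP gI secpi); try exact: IM.
  have := abIJ _ _ Iy Ix; rewrite commgEl conjgE.
  by rewrite invgM !mulgA.
pose V : zmodType := HB.pack Q
  (GRing.isZmodule.Build Q (@mulgA Q) mulC (@mul1g Q) (@mulVg Q)).
by exists V, pi.
Qed.

Section AbelianSectionTheory.
Variables (G : groupType) (V : zmodType) (I J : set G) (pi : G -> V).
Hypotheses (gI : is_subgroup I) (secpi : abelian_section_of I J pi).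

Lemma absection_one : pi 1 = 0%R.
Proof.
case: secpi gI => piM _ _ [I1 _ _].
by apply: (GRing.addrI (pi 1)); rewrite -piM // mulg1 GRing.addr0.
Qed.

Lemma absectionV x : I x -> pi x^-1 = (- pi x)%R.
Proof.
case: secpi gI => piM _ _ [_ _ IV] Ix; apply: (GRing.addrI (pi x)).
by rewrite -piM ?mulgV ?absection_one ?GRing.subrr //; exact: IV.
Qed.

Lemma absectionX x k : I x -> pi (x ^+ k) = (pi x *+ k)%R.
Proof.
case: secpi => piM _ _ Ix; elim: k => [|k IHk]; first exact: absection_one.
by rewrite expgS piM ?IHk -?GRing.mulrS //; exact: subgroup_expg.
Qed.

Lemma absection_eqP x y : I x -> I y -> (pi x = pi y <-> J (x^-1 * y)).
Proof.
case: secpi gI => piM _ piJ [_ IM IV] Ix Iy.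
rewrite -piJ; last by apply: IM => //; exact: IV.
rewrite piM ?absectionV //; last exact: IV.
split=> [->|/eqP]; first by rewrite GRing.addNr.
by rewrite GRing.addrC GRing.subr_eq0 => /eqP.
Qed.

Definition multiples (m : nat) : set G :=
  [set x | I x /\ exists v, pi x = (v *+ m)%R].

Lemma multiples1 : multiples 1 = I.
Proof.
apply/seteqP; split=> x; first by case.
by move=> Ix; split=> //; exists (pi x).
Qed.

Lemma multiples_mul_sub m k : multiples (k * m) `<=` multiples m.
Proof.
by move=> x [Ix [v pix]]; split=> //; exists (v *+ k)%R; rewrite -GRing.mulrnA.
Qed.

Lemma multiples_subgroup m : is_subgroup (multiples m).
Proof.
case: secpi gI => piM _ _ [I1 IM IV].
split=> [|x y [Ix [v xv]] [Iy [w yw]]|x [Ix [v xv]]].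
- by split=> //; exists 0%R; rewrite absection_one GRing.mul0rn.
- split; [exact: IM | exists (v + w)%R].
  by rewrite piM // xv yw GRing.mulrnDl.
- split; [exact: IV | exists (- v)%R].
  by rewrite absectionV // xv GRing.mulNrn.
Qed.

(** Modulo J, the subgroup consists of the m-th powers of elements of I, and
endomorphisms preserve powers. *)
Lemma fully_invariant_multiples m :
  fully_invariant I -> fully_invariant J -> fully_invariant (multiples m).
Proof.
move=> [_ fI] [_ fJ]; split; first exact: multiples_subgroup.
move=> f fM x [Ix [v xv]]; split; first exact: fI.
have [_ onto _] := secpi; have [y Iy yv] := onto v.
have [Ifx Ify] := (fI f fM x Ix, fI f fM y Iy).
exists (pi (f y)); rewrite -absectionX //.
apply/esym/absection_eqP => //; first exact: subgroup_expg.
have fX : f (y ^+ m) = f y ^+ m.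
  elim: m {xv} => [|m IHm]; first exact: morph_one.
  by rewrite !expgS fM IHm.
rewrite -fX -(morph_inv fM) -fM; apply: fJ => //.
apply/absection_eqP => //; first exact: subgroup_expg.
by rewrite absectionX // yv.
Qed.

End AbelianSectionTheory.

(** * Finitely generated abelian groups *)

Section Abelian.
Import GRing.Theory.
Local Open Scope ring_scope.
Variables (V : zmodType) (n : nat) (s : 'I_n -> V).

Definition independent (B : {set 'I_n}) : Prop :=
  forall c : 'I_n -> int,
    \sum_(i in B) s i *~ c i = 0 -> forall i, i \in B -> c i = 0.

(** When the family s generates V, such a B spans a free subgroup of finite
index. *)
Lemma exists_max_independent :
  exists B : {set 'I_n}, independent B /\
    forall j, j \notin B -> ~ independent (j |: B)%SET.
Proof.
have P0 : `[< independent finset.set0 >] by apply/asboolP => c _ i; rewrite inE.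
pose B := [arg max_(B > finset.set0 | `[< independent B >]) #|B|].
exists B; rewrite /B; case: arg_maxnP => // {}B /asboolP indB maxB.
split=> // j jB /asboolP/maxB; rewrite cardsU1 jB; lia.
Qed.

Lemma divisible_int_eq0 (d : int) :
  (forall p, prime p -> exists q : int, d = q * p) -> d = 0.
Proof.
move=> H; have [p lep p_pr] := prime_above `|d|%N; have [q dq] := H p p_pr.
have [//|d0] := eqVneq d 0; move: lep; rewrite {1}dq abszM /=.
have : (0 < `|q|)%N by rewrite absz_gt0; apply: contraNneq d0 => q0; rewrite dq q0 mul0r.
by nia.
Qed.

(** For a finitely generated abelian group V, the subgroup e V is free when e
kills the torsion, and no nonzero element of a free abelian group of finite
rank is divisible by every prime. Rather than splitting off the torsion, the
proof takes e such that e V lies in the span of a maximal independent part of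
the generators. *)
Lemma prime_multiples_eq0 :
  (forall v, exists c : 'I_n -> int, v = \sum_i s i *~ c i) ->
  exists2 e, (0 < e)%N &
    forall v : V, (forall p, prime p -> exists w : V, v = w *+ (p * e)) -> v = 0.
Proof.
move=> gen; have [B [indB maxB]] := exists_max_independent.
pose span (v : V) := exists c : 'I_n -> int, v = \sum_(i in B) s i *~ c i.
have spanD v w : span v -> span w -> span (v + w).
  move=> [c ->] [d ->]; exists (fun i => c i + d i).
  by rewrite -big_split; apply: eq_bigr => i _; rewrite mulrzDr.
have spanZ v k : span v -> span (v *~ k).
  move=> [c ->]; exists (fun i => c i * k).
  by rewrite mulrz_suml; apply: eq_bigr => i _; rewrite mulrzA.
have span0 : span 0 by exists (fun=> 0); rewrite big1.
have /choice[e eP] : forall j : 'I_n, exists e : nat, (0 < e)%N /\ span (s j *+ e).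
  move=> j; have [jB|jB] := boolP (j \in B).
    exists 1%N; split=> //; exists (fun i => (i == j)%:R).
    rewrite (bigD1 j) //= eqxx big1 ?addr0 // => i /andP[_ /negPf->].
    by rewrite mulr0z.
  have /existsNP[c /not_implyP[]] := maxB _ jB.
  rewrite big_setU1 //= => sum0 /existsNP[i /not_implyP[iB ci]].
  have cj : c j <> 0.
    move=> cj0; move: sum0 iB; rewrite cj0 mulr0z add0r => /indB c0.
    by rewrite in_setU1 => /orP[/eqP ij|/c0//]; apply: ci; rewrite ij.
  have spanj : span (s j *~ c j).
    move/eqP: sum0; rewrite addr_eq0 => /eqP->; rewrite -mulrN1z.
    by apply: spanZ; exists c.
  exists `|c j|%N; split; first by lia.
  have -> : s j *+ `|c j| = s j *~ c j *~ Num.sg (c j).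
    by rewrite -mulrzA mulrC -abszEsg.
  exact: spanZ.
have spanS (P : pred 'I_n) (F : 'I_n -> V) : (forall i, span (F i)) -> span (\sum_(i | P i) F i).
  by move=> FP; elim/big_ind: _.
exists (\prod_j e j)%N; first by rewrite prodn_gt0 // => j; case: (eP j).
move=> v vP.
have span_e w : span (w *+ \prod_j e j).
  have [c ->] := gen w; rewrite -sumrMnl; apply: spanS => i.
  rewrite (bigD1 i) //=; set k := (\prod_(j | _) _)%N.
  have -> : s i *~ c i *+ (e i * k)%N = (s i *+ e i) *~ (c i * k%:Z).
    by rewrite !pmulrn -!mulrzA; congr (_ *~ _); lia.
  by apply: spanZ; have [] := eP i.
(* If v = p e w, then v is p times an element of the span of B. By independence
   the coordinates of v are unique, so that each is divisible by every prime. *)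
have vspan p : prime p ->
    exists d : 'I_n -> int, v = \sum_(i in B) s i *~ (d i * p).
  move=> /vP[w ->]; have [d wE] := span_e w; exists d.
  rewrite mulnC mulrnA wE -sumrMnl; apply: eq_bigr => i _.
  by rewrite pmulrn mulrzA.
have [d vE] := vspan 2 isT.
have d0 i : i \in B -> d i * 2%:Z = 0.
  move=> iB; apply: divisible_int_eq0 => p /vspan[d' vE'].
  exists (d' i); apply/eqP; rewrite -subr_eq0; apply/eqP.
  apply: (indB (fun i => d i * 2%:Z - d' i * p)) => //.
  under eq_bigr do rewrite mulrzBr.
  by rewrite sumrB -vE -vE' subrr.
by rewrite vE big1 // => i /d0->.
Qed.

End Abelian.

(** * Ideals of a two-sided skew brace *)

Section Brace.
Variable A : skewBraceType.
Local Notation G := (additive_group A).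
Local Notation M := (multiplicative_group A).

(** The action of the multiplicative group on the additive one by
automorphisms. *)
Definition lambda (a x : G) : G := a^-1 * bmul a x.

Lemma bmulE (a x : G) : bmul a x = a * lambda a x.
Proof. by rewrite /lambda mulVKg. Qed.

Lemma lambdaM a : {morph lambda a : x y / x * y}.
Proof.
move=> x y; rewrite /lambda.
have -> : bmul a (x * y) = (bmul a x : G) * a^-1 * bmul a y :> G by exact: bmulDr.
by rewrite !mulgA.
Qed.

Lemma bone1 : bone = 1 :> G.
Proof.
have := bmulE bone 1; rewrite (morph_one (lambdaM bone)) mulg1 => <-.
exact: bmul1l.
Qed.

Lemma lambda_diff (x y : G) : x^-1 * y = lambda x (bmul (binv x) y).
Proof. by rewrite /lambda bmulA bmulVr bmul1l. Qed.

Lemma lambda_comp (a b x : G) : lambda (bmul a b) x = lambda a (lambda b x).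
Proof.
apply: (@mulgI G (bmul a b)); rewrite -bmulE -bmulA (bmulE b x) (bmulE a (_ * _)).
by rewrite lambdaM mulgA -bmulE.
Qed.

Lemma lambda_one (x : G) : lambda bone x = x.
Proof. by rewrite /lambda bmul1l bone1 invg1 mul1g. Qed.

Lemma diff_lambda (x y : G) : bmul (binv x) y = lambda (binv x) (x^-1 * y).
Proof. by rewrite lambda_diff -lambda_comp bmulVl lambda_one. Qed.

Definition bmul_conj (z x : G) : G := bmul (binv z) (bmul x z).

(** This is where two-sidedness enters: for a skew brace that is not
two-sided, conjugation in the multiplicative group need not respect the
addition. *)
Lemma bmul_conjM (z : G) : two_sided A -> {morph bmul_conj z : x y / x * y}.
Proof.
move=> hA x y; rewrite /bmul_conj.
have -> : bmul (x * y) z = (bmul x z : G) * z^-1 * bmul y z :> G by exact: hA.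
have lz : lambda (binv z) z^-1 = binv z :> G.
  rewrite (morph_inv (lambdaM _)) /lambda bmulVl bone1 mulg1; exact: invgK.
by rewrite !(bmulE (binv z)) !lambdaM lz !mulgA.
Qed.

Hypothesis hA : two_sided A.

Section Ideal.
Variable I : set A.
Hypothesis fiI : fully_invariant (I : set G).

Lemma ideal_lambda (a x : G) : I x -> I (lambda a x).
Proof. by case: fiI => _ fI; apply: fI; exact: lambdaM. Qed.

(** The additive and the multiplicative cosets of I coincide, because the two
differences of x and y are exchanged by the action of x and of its inverse.
In particular the two factor groups of a pair of ideals have the same
cardinality. *)
Lemma ideal_cosetE (x y : A) :
  I ((x : M)^-1 * (y : M)) <-> I ((x : G)^-1 * (y : G)).
Proof.
split=> Ixy; first by rewrite lambda_diff; exact: ideal_lambda.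
by have := ideal_lambda (binv x) Ixy; rewrite -diff_lambda.
Qed.

Lemma ideal_subgroup : is_subgroup (I : set M).
Proof.
have [[I1 IM IV] _] := fiI; have I1' : I (1 : M) by have := I1; rewrite -bone1.
split=> // [x y Ix Iy|x Ix].
  by change (I (bmul x y : G)); rewrite bmulE; apply: IM => //; exact: ideal_lambda.
rewrite -[x^-1]mulg1; apply/ideal_cosetE; apply: IM; first exact: IV.
exact: I1'.
Qed.

Lemma ideal_conj (x y : M) : I x -> I (x ^ y).
Proof. by case: fiI => _ fI; exact: (fI _ (bmul_conjM y hA) x). Qed.

End Ideal.

(** * Multiplicative solvability of additive factors *)

Lemma leq_card_of_factor (B : Type) (K : set B) (E F : finType)
    (rho : B -> E) (pi : B -> F) :
  (forall q, exists2 x, K x & rho x = q) ->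
  (forall x y, K x -> K y -> pi x = pi y -> rho x = rho y) ->
  (#|E| <= #|F|)%N.
Proof.
move=> rho_onto pi_rho.
have /choice[g gP] q : exists x, K x /\ rho x = q.
  by have [x Kx xq] := rho_onto q; exists x.
apply: (@leq_card _ _ (pi \o g)) => q q' /= e.
have [[Kq <-] [Kq' <-]] := (gP q, gP q'); exact: pi_rho.
Qed.

(** If the additive factor I / J is a finite group of exponent p with at most
p ^ n elements, its order is p ^ k with k <= n. The multiplicative factor has
the same order, so it is a p-group of derived length at most n + 1. The family r may
list a coset several times, which only affects the upper bound. *)
Lemma derived_elementary (I J : set A) (p n : nat) (T : finType) (r : T -> A) :
  prime p ->
  fully_invariant (I : set G) -> fully_invariant (J : set G) -> J `<=` I ->
  (forall x : G, I x -> J (x ^+ p)) ->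
  (forall x : G, I x -> exists2 t, I (r t) & J ((r t : G)^-1 * x)) ->
  (#|T| <= p ^ n)%N ->
  derived_from n.+1 (I : set M) `<=` (J : set M).
Proof.
move=> p_pr fiI fiJ JI expI rP cardT.
have [E [rho [secE cardE]]] := exists_finite_section fiI.1 fiJ.1 JI
  (fun x y Jx _ => fully_invariant_normal y fiJ Jx) rP.
have gI := ideal_subgroup fiI.
have rP' (x : M) : I x -> exists2 t, I (r t) & J ((r t : M)^-1 * x).
  by move=> /rP[t It Jt]; exists t => //; apply/(ideal_cosetE fiJ).
have [F [pi [secF cardF]]] := exists_finite_section gI (ideal_subgroup fiJ) JI
  (fun x y Jx _ => ideal_conj fiJ y Jx) rP'.
have [[_ rho_onto rhoJ] [_ pi_onto piJ]] := (secE, secF).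
have pE : p.-group [set: E]%SET.
  rewrite -pnat_exponent (pnat_dvd _ (pnat_id p_pr)) //.
  apply/exponentP => q _; have [x Ix <-] := rho_onto q.
  rewrite -(sectionX fiI.1 secE) //; apply/rhoJ; last exact: expI.
  exact: (subgroup_expg p fiI.1).
have cardEF : #|E| = #|F|.
  apply/eqP; rewrite eqn_leq; apply/andP; split.
    apply: leq_card_of_factor rho_onto _ => x y Ix Iy /(section_eqP gI secF Ix Iy).
    by move=> /(ideal_cosetE fiJ)/(section_eqP fiI.1 secE Ix Iy).
  apply: leq_card_of_factor pi_onto _ => x y Ix Iy /(section_eqP fiI.1 secE Ix Iy).
  by move=> /(ideal_cosetE fiJ)/(section_eqP gI secF Ix Iy).
have pF : p.-group [set: F]%SET by rewrite /pgroup cardsT -cardEF -cardsT.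
move=> x /(derived_section gI secF)[Ix].
by rewrite (derived_pgroup p_pr pF (leq_trans cardF cardT)) => /piJ; apply.
Qed.

(** Let the additive factor V = I / J be abelian with n generators. For every m
and every prime p, the factor m V / p m V has exponent p and at most p ^ n
elements, so n + 1 multiplicative derivations lead from m V to p m V, whatever p
is. Writing e as a product of primes leads from V to e V in a bounded number of
steps, and one further step leads into p e V for all primes p at once; with e as
in [prime_multiples_eq0], these subgroups intersect trivially. *)
Lemma derived_abelian_factor (I J S : set A) :
  finite_set S ->
  fully_invariant (I : set G) -> fully_invariant (J : set G) -> J `<=` I ->
  (forall x y : G, I x -> I y -> J [~ x, y]) ->
  S `<=` I -> I `<=` generated (S `|` J : set G) ->
  exists N, derived_from N (I : set M) `<=` (J : set M).
Proof.
move=> finS fiI fiJ JI abIJ SI genI.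
have [n [s SE]] := finite_set_range (finS : finite_set (S : set G)).
have {SI} Is i : I (s i) by apply: SI; rewrite SE; exists i.
rewrite {}SE in genI; have gI := fiI.1; have [I1 IM IV] := gI.
have [V [pi secpi]] := exists_abelian_section gI fiJ.1 JI abIJ.
have [piM pi_onto piJ] := secpi.
have genV v : exists c : 'I_n -> int, v = (\sum_i pi (s i) *~ c i)%R.
  have [x Ix <-] := pi_onto v; move: (genI x Ix) => {v Ix}.
  suff sub : generated (range s `|` J : set G) `<=`
      [set x | I x /\ exists c : 'I_n -> int, pi x = (\sum_i pi (s i) *~ c i)%R].
    by move=> /sub[].
  apply: generated_sub.
    split=> [|y z [Iy [c yc]] [Iz [d zd]]|y [Iy [c yc]]].
    - split=> //; exists (fun=> 0%R).
      by rewrite big1 ?(absection_one gI secpi).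
    - split; first exact: IM.
      exists (fun i => c i + d i)%R; rewrite piM // yc zd -big_split.
      by apply: eq_bigr => i _; rewrite mulrzDr.
    - split; first exact: IV.
      exists (fun i => - c i)%R; rewrite (absectionV gI secpi) // yc -GRing.sumrN.
      by apply: eq_bigr => i _; rewrite mulrNz.
  move=> y [[i _ <-]|Jy]; last first.
    split; first exact: JI.
    by exists (fun=> 0%R); rewrite big1 //; apply/piJ => //; exact: JI.
  split=> //; exists (fun j => (j == i)%:R)%R.
  by rewrite (bigD1 i) //= eqxx big1 ?GRing.addr0 // => j /negPf->.
have /choice[lift liftP] v : exists x, I x /\ pi x = v.
  by have [x Ix xv] := pi_onto v; exists x.
pose L m : set A := @multiples G V I pi m.
have fiL m : fully_invariant (L m : set G) by exact: (fully_invariant_multiples gI secpi m fiI fiJ).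
have step p m : prime p -> derived_from n.+1 (L m : set M) `<=` (L (p * m)%N : set M).
  move=> p_pr; have p_gt0 := prime_gt0 p_pr.
  (* Representatives of m V / p m V: the combinations of the generators, multiplied
     by m, with coefficients below p. *)
  pose r (t : {ffun 'I_n -> 'I_p}) : A := lift ((\sum_i pi (s i) *+ t i) *+ m)%R.
  have rE t : pi (r t) = ((\sum_i pi (s i) *+ t i) *+ m)%R := (liftP _).2.
  have Ir t : I (r t) := (liftP _).1.
  apply: (derived_elementary (r := r) p_pr) => //.
  - exact: (@multiples_mul_sub G V I pi).
  - move=> x [Ix [v xv]]; split; first exact: subgroup_expg.
    by exists v; rewrite (absectionX gI secpi) // xv -GRing.mulrnA mulnC.
  - move=> x [Ix [v xv]]; have [c vE] := genV v.
    have c_mod i : (`|(c i %% p)%Z| < p)%N.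
      by rewrite -ltz_nat gez0_abs ?modz_ge0 ?ltz_pmod //; lia.
    pose t : {ffun 'I_n -> 'I_p} := [ffun i => Ordinal (c_mod i)].
    have tE i : (c i = (c i %/ p)%Z * p + t i)%R.
      by rewrite ffunE /= gez0_abs -?divz_eq // modz_ge0 //; lia.
    exists t; first by split=> //; eexists; exact: rE.
    split; first by apply: (IM) => //; exact: IV.
    exists (\sum_i pi (s i) *~ (c i %/ p)%Z)%R.
    rewrite piM //; last exact: IV.
    rewrite (absectionV gI secpi) // rE xv vE GRing.mulrnA.
    rewrite GRing.addrC -GRing.mulrnBl; congr (_ *+ _)%R.
    rewrite -GRing.sumrB -GRing.sumrMnl; apply: eq_bigr => i _.
    by rewrite {1}tE mulrzDr mulrzA GRing.addrK.
  - by rewrite card_ffun !card_ord.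
have iter_step e : (0 < e)%N -> exists N, derived_from N (I : set M) `<=` (L e : set M).
  have [k] := ubnP e; elim: k e => // k IHk e le_ek e_gt0.
  have [->|e_neq1] := eqVneq e 1%N.
    by exists 0%N; rewrite /L multiples1.
  have e_gt1 : (1 < e)%N by lia.
  have p_pr := pdiv_prime e_gt1; have p_gt1 := prime_gt1 p_pr.
  have eE := divnK (pdiv_dvd e).
  have d_gt0 : (0 < e %/ pdiv e)%N by rewrite divn_gt0 ?pdiv_gt0 // pdiv_leq.
  have d_lt : (e %/ pdiv e < e)%N by rewrite ltn_Pdiv.
  have [|N NP] := IHk _ _ d_gt0; first by lia.
  exists (n.+1 + N)%N; rewrite /derived_from iterD -eE mulnC.
  by apply: subset_trans (step _ _ p_pr); exact: derived_fromS.
have [e e_gt0 eP] := prime_multiples_eq0 genV.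
have [N NP] := iter_step e e_gt0.
exists (n.+1 + N)%N => x; rewrite /derived_from iterD => Dx.
have Lx p : prime p -> L (p * e)%N x.
  by move=> p_pr; apply: (step _ _ p_pr); apply: derived_fromS Dx.
apply/piJ; first by case: (Lx 2 isT).
by apply: eP => p /Lx[_].
Qed.

Lemma derived_chain (K : nat -> set A) :
  (forall k, exists N, derived_from N (K k : set M) `<=` (K k.+1 : set M)) ->
  forall k, exists N, derived_from N (K 0 : set M) `<=` (K k : set M).
Proof.
move=> KS; elim=> [|k [N NP]]; first by exists 0%N.
have [N' N'P] := KS k; exists (N' + N)%N; rewrite /derived_from iterD.
by apply: subset_trans N'P; exact: derived_fromS.
Qed.

Lemma derived_sub_additive_derived k : finite_set [set: A] ->
  exists N, derived_series M N `<=` (derived_series G k : set A).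
Proof.
move=> finA; apply: (derived_chain (K := derived_series G)) => {}k.
pose I : set A := derived_series G k.
have fiI : fully_invariant (I : set G) := @fully_invariant_derived G k.
apply: (@derived_abelian_factor I _ I) => //.
- exact: sub_finite_set finA.
- exact: (@fully_invariant_derived G k.+1).
- apply: subset_trans (fully_invariant_commutator_sub fiI).
  exact: commutator_subgroupS.
- by move=> x y Ix Iy; exact: mem_commutator.
- by move=> x Ix; apply: sub_generated; left.
Qed.

Lemma derived_sub_additive_lcs k : finitely_generated G ->
  exists N, derived_series M N `<=` (lower_central_series G k : set A).
Proof.
move=> fgG; apply: (derived_chain (K := lower_central_series G)) => {}k.
pose I : set A := lower_central_series G k.
have fiI : fully_invariant (I : set G) := @fully_invariant_lcs G k.
have [S [finS SI genI]] := lcs_factor_generated k fgG.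
apply: (@derived_abelian_factor I _ S) => //.
- exact: (@fully_invariant_lcs G k.+1).
- exact: (fully_invariant_commutator_sub fiI).
- by move=> x y Ix _; exact: (mem_commutator (K := setT) Ix).
Qed.

(** * Residual properties *)

Lemma exists_ideal_quotient (N : set A) : fully_invariant (N : set G) ->
  exists (Q : groupType) (f : {multiplicative M -> Q}),
    section_of ([set: M] : set M) N f.
Proof.
move=> fiN.
have [Q [f secf]] := exists_section (subgroupT M) (ideal_subgroup fiN)
  (fun x y Nx _ => ideal_conj fiN y Nx).
have fM : {morph f : x y / x * y} by case: secf => fM _ _ x y; exact: fM.
pose f' : {multiplicative M -> Q} := HB.pack f (isMultiplicative.Build M Q f fM).
by exists Q, f'.
Qed.

(** The quotient of the multiplicative group by an additive fully invariant
subgroup missing g separates g from the identity. *)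
Lemma residually_of_ideal (P : groupType -> Prop) :
  (forall g : A, g <> (1 : G) -> exists N : set A,
    [/\ fully_invariant (N : set G), ~ N g &
     forall (Q : groupType) (f : {multiplicative M -> Q}),
       section_of [set: M] N f -> P Q]) ->
  residually P M.
Proof.
move=> H g g1; have [|N [fiN Ng PN]] := H g.
  by move=> g0; apply: g1; rewrite g0 -bone1.
have [Q [f secf]] := exists_ideal_quotient fiN.
have [_ f_onto fN] := secf.
exists Q, f; split; [|exact: PN secf|by move=> /fN-/(_ I)].
by apply/seteqP; split=> // q _; have [x _ <-] := f_onto q; exists x.
Qed.

(** The intersection of the kernels of all homomorphisms to H: it is fully
invariant, whereas a single kernel need not be. *)
Definition common_kernel (H : groupType) : set A :=
  [set x | forall f : G -> H, {morph f : x y / x * y} -> f x = 1].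

Lemma fully_invariant_common_kernel (H : groupType) :
  fully_invariant (common_kernel H : set G).
Proof.
split; first split=> [f fM|x y Nx Ny f fM|x Nx f fM].
- exact: morph_one.
- by rewrite fM Nx // Ny // mulg1.
- by rewrite morph_inv // Nx // invg1.
move=> phi phiM x Nx f fM; apply: (Nx (f \o phi)) => y z /=.
by rewrite phiM fM.
Qed.

(** A homomorphism from G to the finite group H is determined by the images of
the generators, so there are finitely many, and an element of the quotient is
determined by its values under them. *)
Lemma common_kernel_finite_index (H Q : groupType) (pi : M -> Q) :
  finitely_generated G -> finite_group H ->
  section_of [set: M] (common_kernel H) pi -> finite_group Q.
Proof.
move=> [S [finS genS]] finH secpi; have [_ pi_onto _] := secpi.
have [n [s SE]] := finite_set_range finS.
have [m [h hE]] := finite_set_range finH.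
have hom_eq (f f' : G -> H) : {morph f : x y / x * y} ->
    {morph f' : x y / x * y} -> (forall i, f (s i) = f' (s i)) -> f =1 f'.
  move=> fM f'M ff' x; have : generated S x by rewrite genS.
  apply: (@generated_sub _ _ [set x | f x = f' x]).
    split=> [|y z /= fy fz|y /= fy] /=; first by rewrite !morph_one.
      by rewrite fM f'M fy fz.
    by rewrite !morph_inv // fy.
  by rewrite SE => _ [i _ <-]; exact: ff'.
have /choice[c cK] (y : H) : exists j, h j = y.
  by have : range h y; [rewrite -hE | case=> j _; exists j].
(* Homomorphisms are indexed by the tuples t of images of the generators; tuples
   that extend to no homomorphism receive a constant function. *)
have /choice[F FP] (t : {ffun 'I_n -> 'I_m}) : exists F : G -> H,
    forall f : G -> H, {morph f : x y / x * y} ->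
      (forall i, f (s i) = h (t i)) -> F =1 f.
  have [[f [fM fE]]|nf] := pselect (exists f : G -> H,
      {morph f : x y / x * y} /\ forall i, f (s i) = h (t i)).
    by exists f => f' f'M f'E; apply: hom_eq => // i; rewrite fE f'E.
  by exists (fun=> 1) => f fM fE; case: nf; exists f.
have /choice[lift liftK] q : exists x, pi x = q.
  by have [x _ <-] := pi_onto q; exists x.
apply: (@finite_set_inj _ {ffun {ffun 'I_n -> 'I_m} -> 'I_m}
  (fun q => [ffun t => c (F t (lift q))])) => q q' /ffunP eqF.
rewrite -(liftK q) -(liftK q').
apply/(section_eqP (subgroupT M) secpi) => //.
apply/(ideal_cosetE (fully_invariant_common_kernel H)) => f fM.
rewrite fM morph_inv //.
pose t := [ffun i => c (f (s i))].
have tE i : f (s i) = h (t i) by rewrite ffunE cK.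
have := eqF t; rewrite !ffunE => /(congr1 h); rewrite !cK !(FP t f fM tE) => ->.
by rewrite mulVg.
Qed.

End Brace.

Theorem theorem4p3 (A : skewBraceType) (hA : two_sided A) :
  [/\ finite_set [set: A] -> solvable_group (additive_group A) ->
        solvable_group (multiplicative_group A),
      finitely_generated (additive_group A) ->
        nilpotent_group (additive_group A) ->
        solvable_group (multiplicative_group A),
      finitely_generated (additive_group A) ->
        residually nilpotent_group (additive_group A) ->
        residually solvable_group (multiplicative_group A)
    & finitely_generated (additive_group A) ->
        residually finite_group (additive_group A) ->
        residually finite_group (multiplicative_group A)].
Proof.
have solvable_of N : derived_series (multiplicative_group A) N `<=`
    [set (1 : additive_group A)] -> solvable_group (multiplicative_group A).
  move=> D1; exists N; apply/seteqP; split=> [x /D1->|_ ->].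
    by rewrite /= -bone1.
  by case: (subgroup_derived_from N (subgroupT (multiplicative_group A))).
split.
- move=> finA [k kE]; have [N] := derived_sub_additive_derived hA k finA.
  by rewrite kE; exact: solvable_of.
- move=> fgA [k kE]; have [N] := derived_sub_additive_lcs hA k fgA.
  by rewrite kE; exact: solvable_of.
- move=> fgA resA; apply: (residually_of_ideal hA) => g g1.
  have [H [f [_ [k kE] fg1]]] := resA g g1.
  exists (lower_central_series (additive_group A) k); split.
  + exact: fully_invariant_lcs.
  + by move=> /(lcs_morph (@gmulfM _ _ f)); rewrite kE.
  move=> Q pi secpi; have [N NP] := derived_sub_additive_lcs hA k fgA.
  have [_ _ piJ] := secpi.
  exists N; apply/seteqP; split=> [q|_ ->]; last first.
    by case: (subgroup_derived_from N (subgroupT Q)).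
  move=> /(derived_section_onto (subgroupT _) secpi)[x /NP Jx <-].
  by apply/piJ.
- move=> fgA resA; apply: (residually_of_ideal hA) => g g1.
  have [H [f [_ finH fg1]]] := resA g g1.
  exists (common_kernel H); split.
  + exact: fully_invariant_common_kernel.
  + by move=> /(_ f (@gmulfM _ _ f)).
  by move=> Q pi; exact: common_kernel_finite_index.
Qed.
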